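(* Let $G$ be any $2$-connected graph with at least two distinct connected $2$-partitions $P,Q\in P_2(G)$, neither of which has the empty set as a block, and let $n=|V(G)|$. Then the family of flip walks on $P_2(D_d(G))$, $d\ge 1$, is torpidly mixing. In particular, for all $d\ge1$, $\Phi(P_2(D_d(G)))\le (d+1)2^{-d-1}$, $t_{mix}(1/4)\ge \frac{2^{d-1}}{d+1}$ for the flip walk on $P_2(D_d(G))$, and $|P_2(D_d(G))|\le 2^{|V(D_d(G))|}\le 2^{n+dn^2}$.
   Context: $P_2(H)$ is the set of ordered pairs $(A,B)$ of disjoint vertex sets with union $V(H)$, each inducing a connected subgraph. The doubled $d$-star construction $D_d(G)$ replaces each edge of $G$ by $d$ parallel edges and then subdivides each new edge once. Flip walk: put a graph structure on $P_2(H)$: for $(A,B)\in P_2(H)$ and $x\in V(H)$, the move to $(A\cup\{x\},B\setminus\{x\})$ is an edge if this lies in $P_2(H)$ (including when it equals $(A,B)$) and otherwise a self-loop at $(A,B)$; similarly for $(A\setminus\{x\},B\cup\{x\})$; this gives a $|V(H)|$-regular graph, and the flip walk is the lazy simple random walk on it. For a lazy random walk $M$ on a $\Delta$-regular graph $K$, the conductance is $\Phi(M)=\min_{U\subset V(K),\,|U|\le |V(K)|/2}\frac{|\partial_E U|}{2\Delta|U|}$, where $\partial_E U$ is the set of edges with exactly one endpoint in $U$. The mixing time is $t_{mix}(\epsilon)=\inf\{t:\max_x\|P^t\delta_x-\mu\|_{TV}\le\epsilon\}$ with $\mu$ stationary. A family of chains is torpidly mixing if there is an exponentially growing $f$ with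 $t_{mix}^M(1/4)\ge f(\log|M|)$ for all chains $M$ in the family, $|M|$ the size of the state space. *)

(* Defs.v *)
From HB Require Import structures.
From mathcomp Require Import all_boot all_order all_algebra.
From mathcomp Require Import boolp classical_sets reals ereal constructive_ereal exp.

Set Implicit Arguments.
Unset Strict Implicit.
Unset Printing Implicit Defensive.

Import Order.TTheory GRing.Theory Num.Theory.
Local Open Scope ring_scope.

(** * Graphs *)

Record sgraph := SGraph {
  svertex :> finType;
  sedge : rel svertex;
  sedge_sym : symmetric sedge;
  sedge_irr : irreflexive sedge }.

(* The empty set induces a connected subgraph: (V(H), set0) belongs to P_2(H)
   whenever H is connected. *)
Definition connected_in (G : sgraph) (A : {set G}) : bool :=
  [forall x in A, forall y in A,
    connect [rel u v | [&& u \in A, v \in A & sedge u v]] x y].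

Definition two_connected (G : sgraph) : Prop :=
  [/\ (2 < #|G|)%N, connected_in [set: G] &
      forall v : G, connected_in [set~ v]].

(* Loopless multigraphs; an edge carries its set of endpoints. *)
Record mgraph := MGraph {
  mvertex : finType;
  medge : finType;
  mends : medge -> {set mvertex} }.

Definition edge_set (G : sgraph) : {set {set G}} :=
  [set [set p.1; p.2] | p in [pred p : G * G | sedge p.1 p.2]].

Definition mgraph_of (G : sgraph) : mgraph :=
  @MGraph G {s : {set G} | s \in edge_set G} val.

Definition parallel (d : nat) (M : mgraph) : mgraph :=
  @MGraph (mvertex M) (medge M * 'I_d)%type (fun e => mends e.1).

Section Subdivide.
Variable M : mgraph.

Definition subdivide_edge : rel (mvertex M + medge M) := fun a b =>
  match a, b with
  | inl v, inr e | inr e, inl v => v \in mends e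
  | _, _ => false
  end.

Lemma subdivide_edge_sym : symmetric subdivide_edge.
Proof. by case=> [v|e] [w|f]. Qed.

Lemma subdivide_edge_irr : irreflexive subdivide_edge.
Proof. by case. Qed.

Definition subdivide : sgraph := SGraph subdivide_edge_sym subdivide_edge_irr.
End Subdivide.

Definition dstar (d : nat) (G : sgraph) : sgraph :=
  subdivide (parallel d (mgraph_of G)).

(** * Connected 2-partitions *)

Definition is_conn2 (H : sgraph) (p : {set H} * {set H}) : bool :=
  [&& [disjoint p.1 & p.2], p.1 :|: p.2 == [set: H],
      connected_in p.1 & connected_in p.2].

Definition P2 (H : sgraph) : finType :=
  {p : {set H} * {set H} | is_conn2 p}.

(** * Regular graphs and lazy walks *)

(* Undirected multigraphs given by edge multiplicities. [rmult x x] is the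
   number of self-loops at x, each of which contributes 1 to the degree. *)
Record rgraph := RGraph {
  rvertex :> finType;
  rmult : rvertex -> rvertex -> nat;
  rdeg : nat;
  rmult_sym : forall x y, rmult x y = rmult y x;
  rmult_deg : forall x, (\sum_y rmult x y)%N = rdeg }.

(* Each boundary edge is counted once, from its endpoint in U. *)
Definition edge_boundary (K : rgraph) (U : {set K}) : nat :=
  (\sum_(x in U) \sum_(y in ~: U) rmult x y)%N.

Section Chains.
Variable R : realType.

(* U ranges over nonempty sets, the quotient being meaningless for U = set0. *)
Definition conductance (K : rgraph) : \bar R :=
  \big[Order.min/+oo%E]_(U : {set K} | (U != finset.set0) && (#|U| * 2 <= #|K|)%N)
    ((edge_boundary U)%:R / ((2 * rdeg K * #|U|)%N)%:R)%:E.

Record chain := Chain {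
  state :> finType;
  trans : state -> state -> R }.

Definition lazy_walk (K : rgraph) : chain :=
  @Chain K (fun x y =>
    (x == y)%:R / 2 + (rmult x y)%:R / ((2 * rdeg K)%N)%:R).

Definition stationary (M : chain) (mu : M -> R) : Prop :=
  [/\ forall x, 0 <= mu x, \sum_x mu x = 1 &
      forall y, \sum_x mu x * trans x y = mu y].

Definition dirac_at (M : chain) (x : M) : M -> R := fun y => (x == y)%:R.

Definition evolve (M : chain) (p : M -> R) : M -> R :=
  fun y => \sum_x p x * trans x y.

Definition tv_dist (T : finType) (p q : T -> R) : R :=
  (\sum_x `|p x - q x|) / 2.

(* Equal to +oo if the distance eps is never reached. *)
Definition tmix (M : chain) (mu : M -> R) (eps : R) : \bar R :=
  ereal_inf [set t%:R%:E | t in [set t : nat | forall x : M,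
    tv_dist (iter t (@evolve M) (dirac_at x)) mu <= eps]]%classic.

Definition exp_growing (f : R -> R) : Prop :=
  exists C a x0 : R, [/\ 0 < C, 1 < a &
    forall x, x0 <= x -> C * a `^ x <= f x].

Definition torpidly_mixing (I : Type) (J : set I) (M : I -> chain) : Prop :=
  exists2 f : R -> R, exp_growing f &
    forall i, J i -> forall mu : M i -> R, stationary mu ->
      ((f (ln #|M i|%:R))%:E <= tmix mu 4^-1)%E.

Lemma lazy_walk_stochastic (K : rgraph) (x : lazy_walk K) :
  (0 < rdeg K)%N -> \sum_y trans x y = 1.
Proof.
move=> K0; rewrite big_split /= -!mulr_suml -natr_sum -natr_sum rmult_deg.
rewrite (bigD1 x) //= eqxx big1 ?addn0; last first.
  by move=> y /negbTE; rewrite eq_sym => ->.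
rewrite natrM invfM mulrCA divff ?pnatr_eq0 -?lt0n // mulr1 mul1r.
by rewrite [RHS]splitr mul1r.
Qed.

Lemma lazy_walk_uniform (K : rgraph) : (0 < rdeg K)%N -> (0 < #|K|)%N ->
  @stationary (lazy_walk K) (fun=> #|K|%:R^-1).
Proof.
move=> K0 cK; split=> [x||y]; first by rewrite invr_ge0.
  by rewrite sumr_const -[_ *+ _]mulr_natr mulVf // pnatr_eq0 -lt0n.
rewrite -mulr_sumr -[RHS]mulr1; congr (_ * _).
rewrite -[RHS](lazy_walk_stochastic y K0); apply: eq_bigr => x _ /=.
by rewrite eq_sym rmult_sym.
Qed.

End Chains.

(** * The flip walk *)

Section Flip.
Variable H : sgraph.

(* [pair_move true x] adds x to the first block, [pair_move false x] to the
   second one. *)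
Definition pair_move (b : bool) (x : H) (p : {set H} * {set H}) :=
  if b then (x |: p.1, p.2 :\ x) else (p.1 :\ x, x |: p.2).

(* [insubd s] turns the moves that leave P_2(H) into self-loops at s. *)
Definition move (b : bool) (x : H) (s : P2 H) : P2 H :=
  insubd s (pair_move b x (val s)).

(* For each x exactly one of the two moves, the one adding x to the block that
   does not contain it, is not the identity on pairs: these |V(H)| moves are
   the edges at s. The identity moves are the holding half of the lazy walk,
   see flip_walkE. *)
Definition flip (x : H) (s : P2 H) : P2 H :=
  move (x \notin (val s).1) x s.

Definition flip_mult (s t : P2 H) : nat := #|[set x | flip x s == t]|.

Lemma P2_compl (s : P2 H) x : (x \in (val s).2) = (x \notin (val s).1).
Proof.
case: s => -[A B] /= /and4P[/= dAB /eqP cAB _ _].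
have /setP/(_ x) := cAB; rewrite !inE.
case: (boolP (x \in A)) => //= xA _.
by apply/negbTE; rewrite (disjointFr dAB).
Qed.

Lemma move_id (s : P2 H) x : move (x \in (val s).1) x s = s.
Proof.
rewrite /move /pair_move; have := P2_compl s x.
case: (boolP (x \in (val s).1)) => xA /= xB.
  have -> : (x |: (val s).1, (val s).2 :\ x) = val s.
    rewrite [RHS]surjective_pairing; congr pair; apply/setP => y; rewrite !inE.
      by case: eqP => // ->.
    by case: eqP => // ->; rewrite xB.
  by rewrite valKd.
have -> : ((val s).1 :\ x, x |: (val s).2) = val s.
  rewrite [RHS]surjective_pairing; congr pair; apply/setP => y; rewrite !inE.
    by case: eqP => // ->; rewrite (negbTE xA).
  by case: eqP => // ->.
by rewrite valKd.
Qed.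

Lemma flip_inv x (s t : P2 H) : flip x s = t -> s != t -> flip x t = s.
Proof.
rewrite /flip /move /insubd; case: insubP => /= [u _ vu <- {t} _|_ ->];
  last by rewrite eqxx.
suff -> : pair_move (x \notin (val u).1) x (val u) = val s by rewrite valK.
case: u vu => p Pp /= ->; rewrite /pair_move; have := P2_compl s x.
case: (boolP (x \in (val s).1)) => xA /= xB; rewrite !inE eqxx /=;
  rewrite [RHS]surjective_pairing; congr pair; apply/setP => y; rewrite !inE;
  by case: eqP => // ->; rewrite ?xB ?xA ?(negbTE xA).
Qed.

Lemma flip_mult_sym s t : flip_mult s t = flip_mult t s.
Proof.
case: (eqVneq s t) => [-> //|st].
rewrite /flip_mult; apply: eq_card => x.
rewrite [LHS]finset.in_set [RHS]finset.in_set.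
apply/eqP/eqP => e; first exact: flip_inv e st.
by apply: flip_inv e _; rewrite eq_sym.
Qed.

Lemma flip_mult_deg s : (\sum_t flip_mult s t)%N = #|H|.
Proof.
rewrite -sum1_card (partition_big (flip^~ s) predT) //=.
apply: eq_bigr => t _; rewrite /flip_mult -sum1_card; apply: eq_bigl => x.
by rewrite inE.
Qed.

Definition flip_graph : rgraph := RGraph flip_mult_sym flip_mult_deg.

Definition flip_walk (R : realType) : chain R := lazy_walk R flip_graph.

Lemma flip_walkE (R : realType) (s t : flip_walk R) : (0 < #|H|)%N ->
  trans s t = #|[set p : H * bool | move p.2 p.1 s == t]|%:R
                / ((2 * #|H|)%N)%:R :> R.
Proof.
move=> H0; suff -> : #|[set p : H * bool | move p.2 p.1 s == t]| =
  ((s == t) * #|H| + flip_mult s t)%N.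
  rewrite natrD mulrDl /= !natrM; congr (_ + _).
  by rewrite invfM mulrACA divff ?mulr1 // pnatr_eq0 -lt0n.
rewrite -sum1_card big_mkcond /=.
rewrite (eq_bigr (fun p : H * bool => (move p.2 p.1 s == t) : nat)); last first.
  by move=> p _; rewrite inE; case: eqP.
rewrite -(pair_bigA _ (fun x b => (move b x s == t) : nat)) /=.
rewrite (eq_bigr (fun x => ((s == t) + (flip x s == t))%N)); last first.
  move=> x _; rewrite big_bool /flip; have := move_id s x.
  by case: (x \in (val s).1) => ->; [reflexivity|rewrite [LHS]addnC; reflexivity].
rewrite big_split; apply: (congr2 addn); first by rewrite sum_nat_const mulnC.
rewrite /flip_mult -sum1_card [RHS]big_mkcond.
by apply: eq_bigr => x _; rewrite finset.in_set; case: (flip x s == t).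
Qed.

End Flip.

(* Main.v *)
Require Import Defs.
From mathcomp Require Import boolp classical_sets reals ereal constructive_ereal.
From mathcomp Require Import sequences exp.
From mathcomp Require Import all_boot all_order all_algebra.
From mathcomp Require Import ring lra zify.

(** The partitions of D_d(G) restricting to a fixed partition (S, ~S) of G into
    nonempty connected parts form a bottleneck. In such a partition the copies of
    an edge inside S or inside ~S must follow their endpoints, while the copies of
    an edge between S and ~S are free. A flip of a subdivision vertex does not
    change the restriction to G. A flip of a vertex v of G does so only if at most
    one of the d copies of each cut edge e at v belongs to the block that v leaves,
    because afterwards both endpoints of e are in the other block; this happens for
    at most a fraction (d+1)/2^d of the partitions. As P and Q give disjoint sets of this
    kind, one of them contains at most half of P_2(D_d(G)). *)

Set Implicit Arguments.
Unset Strict Implicit.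
Unset Printing Implicit Defensive.

Import Order.TTheory GRing.Theory Num.Theory.
Local Open Scope ring_scope.

(** * Total variation and stationary distributions of finite chains *)

Section ChainTheory.
Variables (R : realType) (M : chain R).
Implicit Types (p q mu : M -> R).

Lemma evolveE p y : evolve p y = \sum_x p x * trans x y.
Proof. by []. Qed.

(** Linearity of the evolution: it carries bounds on the rows of the t-step matrix over to arbitrary
    starting vectors. *)
Lemma iter_evolveE t p y :
  iter t (@evolve R M) p y =
  \sum_x p x * iter t (@evolve R M) (dirac_at x) y.
Proof.
elim: t y => [|t IHt] y /=.
  rewrite (bigD1 y) //= /dirac_at eqxx mulr1 big1 ?addr0 // => x /negbTE ->.
  by rewrite mulr0.
rewrite [LHS]evolveE.
under [LHS]eq_bigr do rewrite IHt mulr_suml.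
rewrite exchange_big; apply: eq_bigr => x _ /=.
by rewrite /evolve mulr_sumr; apply: eq_bigr => z _; rewrite mulrA.
Qed.

Lemma iter_evolve_stationary t mu : stationary mu ->
  iter t (@evolve R M) mu =1 mu.
Proof.
case=> _ _ st; elim: t => //= t IHt y.
by rewrite -[RHS]st; apply: eq_bigr => x _; rewrite IHt.
Qed.

(** Convexity of total variation: [q] is its own average under [w], so the triangle inequality
    applies term by term. *)
Lemma tv_dist_mean (w : M -> R) (F : M -> M -> R) q (eps : R) :
  (forall x, 0 <= w x) -> \sum_x w x = 1 ->
  (forall x, tv_dist (F x) q <= eps) ->
  tv_dist (fun y => \sum_x w x * F x y) q <= eps.
Proof.
move=> w0 w1 Fq; rewrite -[eps]mul1r -w1 mulr_suml.
apply: le_trans (ler_sum _ (fun x _ => ler_wpM2l (w0 x) (Fq x))).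
rewrite /tv_dist; under [leRHS]eq_bigr do rewrite mulrA mulr_sumr.
rewrite -mulr_suml ler_pM2r ?invr_gt0 // exchange_big; apply: ler_sum => y _.
rewrite -{1}[q y]mul1r -w1 mulr_suml -sumrB.
apply: le_trans (ler_norm_sum _ _ _) _; apply: ler_sum => x _.
by rewrite -mulrBr normrM (ger0_norm (w0 x)).
Qed.

(* If all rows of P^t are within 1/4 of mu, then P^t contracts differences of
   stationary distributions by a factor 1/2, hence they vanish. *)
Lemma mixed_stationary_uniq t mu nu : stationary mu -> stationary nu ->
  (forall x, tv_dist (iter t (@evolve R M) (dirac_at x)) mu <= 4^-1) ->
  mu =1 nu.
Proof.
move=> smu snu mix; pose D := \sum_x `|mu x - nu x|.
have D0 : 0 <= D by apply: sumr_ge0.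
have [_ mu1 _] := smu; have [_ nu1 _] := snu.
suff leD : D <= D * 2^-1.
  have /eqP : D = 0 by lra.
  rewrite psumr_eq0 => [/allP D_0 x|//].
  by have := D_0 x (mem_index_enum x); rewrite normr_eq0 subr_eq0 => /eqP.
(* Subtracting [mu y] from every row changes nothing, because [mu - nu] has total mass zero. *)
have eqd y : mu y - nu y = \sum_x (mu x - nu x) *
    (iter t (@evolve R M) (dirac_at x) y - mu y).
  under eq_bigr do rewrite mulrBr mulrBl.
  rewrite sumrB -[X in _ = _ - X]mulr_suml [X in _ - X * _]sumrB mu1 nu1.
  rewrite subrr mul0r subr0 sumrB.
  by rewrite -!iter_evolveE !iter_evolve_stationary.
rewrite {1}/D; under eq_bigr do rewrite eqd.
apply: le_trans (ler_sum _ (fun y _ => ler_norm_sum _ _ _)) _.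
rewrite exchange_big /D mulr_suml; apply: ler_sum => x _ /=.
under eq_bigr do rewrite normrM.
rewrite -mulr_sumr ler_wpM2l //.
by have := mix x; rewrite /tv_dist; lra.
Qed.

(** The surplus of [p] over [q] on [U] is balanced by an equal deficit outside, so it enters the sum
    of absolute values twice, which cancels the factor 1/2. *)
Lemma tv_dist_ge_set p q (U : {set M}) :
  \sum_x p x = \sum_x q x ->
  \sum_(x in U) (p x - q x) <= tv_dist p q.
Proof.
move=> pq; have s0 : \sum_x (p x - q x) = 0 by rewrite sumrB pq subrr.
rewrite /tv_dist [X in _ <= X / 2](bigID (mem U)) /=.
move: s0; rewrite (bigID (mem U)) /=.
have h1 := ler_norm (\sum_(x in U) (p x - q x)).
have h2 := ler_norm (- \sum_(x | x \notin U) (p x - q x)).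
rewrite normrN in h2.
have h3 := ler_norm_sum (index_enum M) (fun x => p x - q x) (mem U).
have h4 := ler_norm_sum (index_enum M) (fun x => p x - q x) [pred x | x \notin U].
rewrite /= in h1 h2 h3 h4 *; lra.
Qed.

End ChainTheory.

(** * From a sparse cut to a lower bound on the mixing time *)

Section LazyWalk.
Variables (R : realType) (K : Defs.rgraph).
Hypothesis K0 : (0 < rdeg K)%N.
Local Notation M := (lazy_walk R K).

Lemma lazy_walk_stochastic_col (y : M) : \sum_x trans x y = 1.
Proof.
rewrite -[RHS](lazy_walk_stochastic y K0); apply: eq_bigr => x _ /=.
by rewrite eq_sym rmult_sym.
Qed.

Lemma lazy_trans_ge0 (x y : M) : 0 <= trans x y.
Proof. by rewrite addr_ge0 ?divr_ge0. Qed.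

Variable U : {set K}.
Hypothesis U0 : U != finset.set0.

(** The quantity minimised in the conductance; by [cut_ratioE] it is the probability of leaving [U]
    in one step from a uniform point of [U]. *)
Definition cut_ratio : R :=
  (edge_boundary U)%:R / ((2 * rdeg K * #|U|)%N)%:R.

Let piU : M -> R := fun x => (x \in U)%:R / #|U|%:R.
Let cU : (0 : R) < #|U|%:R. Proof. by rewrite ltr0n card_gt0. Qed.

Lemma unif_sum : \sum_x piU x = 1.
Proof.
by rewrite -mulr_suml -natr_sum -sum1_card -big_mkcond sum1_card divff ?gt_eqF.
Qed.

Lemma evolve_sum (p : M -> R) : \sum_y evolve p y = \sum_x p x.
Proof.
rewrite exchange_big; apply: eq_bigr => x _ /=.
by rewrite -mulr_sumr lazy_walk_stochastic ?mulr1.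
Qed.

Lemma iter_evolve_sum t (p : M -> R) :
  \sum_y iter t (@evolve R M) p y = \sum_x p x.
Proof. by elim: t => //= t <-; rewrite evolve_sum. Qed.

(* The uniform distribution on U is at most |K|/|U| times the stationary uniform
   distribution on K, and this is preserved by the walk. *)
Lemma iter_evolve_unif_bound t y :
  0 <= iter t (@evolve R M) piU y <= #|U|%:R^-1.
Proof.
elim: t y => [|t IHt] y /=.
  rewrite /piU; case: (y \in U); rewrite ?mul1r ?mul0r ?lexx ?andbT.
    by rewrite invr_ge0.
  by rewrite invr_ge0 ler0n.
rewrite evolveE sumr_ge0 => [/=|x _]; last first.
  by rewrite mulr_ge0 ?lazy_trans_ge0 //; case/andP: (IHt x).
rewrite -[leRHS]mulr1 -[X in _ <= _ * X](lazy_walk_stochastic_col y) mulr_sumr.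
apply: ler_sum => x _; apply: ler_wpM2r; first exact: lazy_trans_ge0.
by case/andP: (IHt x).
Qed.

Lemma cut_ratioE :
  cut_ratio = #|U|%:R^-1 * \sum_(x in U) \sum_(y in ~: U) (trans (x : M) y).
Proof.
rewrite /cut_ratio /edge_boundary natr_sum mulr_suml mulr_sumr.
apply: eq_bigr => x xU; rewrite natr_sum mulr_suml mulr_sumr.
apply: eq_bigr => y; rewrite finset.in_setC => yU /=.
have /negbTE -> : x != y by apply: contraNneq yU => <-.
by rewrite mul0r add0r (natrM _ (2 * _)) invfM [RHS]mulrC -[RHS]mulrA.
Qed.

(** One step adds at most [cut_ratio] to the mass outside [U]: no point of [U] ever carries more
    than [1/#|U|], its share in the initial uniform distribution [piU]. *)
Lemma escape_mass t :
  \sum_(y in ~: U) iter t (@evolve R M) piU y <= t%:R * cut_ratio.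
Proof.
elim: t => [|t IHt].
  rewrite mul0r big1 // => y; rewrite finset.in_setC /= /piU => /negbTE ->.
  by rewrite mul0r.
rewrite -natr1 mulrDl mul1r.
set p := iter t (@evolve R M) piU in IHt *.
have bp x : 0 <= p x <= #|U|%:R^-1 by apply: iter_evolve_unif_bound.
rewrite iterS -/p.
under eq_bigr do rewrite evolveE.
(* Split by origin: mass already outside [U], bounded by induction, and mass crossing from [U]. *)
rewrite exchange_big /= (bigID (mem U)) /= addrC lerD //.
  apply: le_trans IHt.
  rewrite [leRHS](eq_bigl (fun x => x \notin U)) => [|x]; last first.
    by rewrite finset.in_setC.
  apply: ler_sum => x _; rewrite -mulr_sumr -[leRHS]mulr1.
  have /andP[p0 _] := bp x.
  apply: ler_wpM2l => //; rewrite -[leRHS](lazy_walk_stochastic x K0).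
  rewrite [leRHS](bigID (mem (~: U))) /= lerDl sumr_ge0 //.
rewrite cut_ratioE mulr_sumr; apply: ler_sum => x _; rewrite -mulr_sumr.
have /andP[_ pU] := bp x; apply: ler_wpM2r => //.
by apply: sumr_ge0 => y _; apply: lazy_trans_ge0.
Qed.

Hypothesis halfU : (#|U| * 2 <= #|K|)%N.

(** At time [t] the walk from [piU] has mass at least [1 - t * cut_ratio] in [U], while [mu] has at
    most 1/2 there; a distance of at most 1/4 forces [t * cut_ratio >= 1/4]. *)
Lemma mixed_time_ge t (mu : M -> R) : stationary mu ->
  (forall x, tv_dist (iter t (@evolve R M) (dirac_at x)) mu <= 4^-1) ->
  1 <= 4 * (t%:R * cut_ratio).
Proof.
move=> smu mix.
have K_gt0 : (0 < #|K|)%N.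
  by apply: leq_trans (max_card (mem U)); rewrite card_gt0.
(* Mixing at time [t] identifies [mu] with the uniform distribution. *)
have muE := mixed_stationary_uniq smu (lazy_walk_uniform R K0 K_gt0) mix.
have piU0 x : 0 <= piU x by rewrite divr_ge0.
have := tv_dist_mean piU0 unif_sum mix.
have -> : (fun y => \sum_x piU x * iter t (@evolve R M) (dirac_at x) y) =
    iter t (@evolve R M) piU.
  by apply: funext => y; rewrite -iter_evolveE.
set p := iter t _ piU => tvp.
have p1 : \sum_y p y = 1 by rewrite iter_evolve_sum unif_sum.
have [_ mu1 _] := smu.
have := @tv_dist_ge_set R M p mu U (etrans p1 (esym mu1)); rewrite sumrB.
have : \sum_(x in U) mu x <= 2^-1.
  under eq_bigr do rewrite muE; rewrite sumr_const -[_ *+ _]mulr_natl.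
  rewrite ler_pdivrMr ?ltr0n // ler_pdivlMl ?ltr0n //.
  by rewrite mulrC -natrM ler_nat.
have : \sum_(x in U) p x + \sum_(x in ~: U) p x = 1.
  rewrite -[RHS]p1 [RHS](bigID (mem U)) /=; congr (_ + _).
  by apply: eq_bigl => x; rewrite finset.in_setC.
have := escape_mass t; rewrite -/p; lra.
Qed.

Lemma conductance_le_cut : (conductance R K <= cut_ratio%:E)%E.
Proof. by apply: bigmin_le_cond; rewrite U0 halfU. Qed.

Lemma tmix_ge (c : R) (mu : M -> R) : 0 < c -> cut_ratio <= c ->
  stationary mu -> ((4 * c)^-1%:E <= tmix mu 4^-1)%E.
Proof.
move=> c0 Uc smu; apply: le_ereal_inf_tmp => _ [t mix <-].
have := mixed_time_ge smu mix; rewrite lee_fin => ge1.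
rewrite -[leLHS]mul1r ler_pdivrMr ?mulr_gt0 // mulrCA.
by apply: le_trans ge1 _; rewrite ler_pM2l // ler_wpM2l.
Qed.

End LazyWalk.

(** * Connected blocks and the effect of a flip *)

Section Connectivity.
Variables (H : sgraph) (A : {set H}).

Lemma connected_in_neighbour x y : connected_in A -> x \in A -> y \in A ->
  x != y -> exists2 z, z \in A & sedge x z.
Proof.
move=> /forall_inP/(_ x) cA xA yA; have /forall_inP/(_ _ yA) := cA xA.
case/connectP=> -[|z p] /=; first by move=> _ ->; rewrite eqxx.
by case/andP=> /and3P[_ zA xz] _ _ _; exists z.
Qed.

End Connectivity.

Lemma P2_eq (H : sgraph) (s t : P2 H) : (val s).1 =i (val t).1 -> s = t.
Proof.
move=> st; apply: val_inj; rewrite [LHS]surjective_pairing.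
rewrite [RHS]surjective_pairing; congr pair; apply/setP => x //.
by rewrite !P2_compl st.
Qed.

Lemma first_block_inj (H : sgraph) : injective (fun s : P2 H => (val s).1).
Proof. by move=> s t st; apply: P2_eq; rewrite /= st. Qed.

(** The blocks are indexed by a boolean, [true] for the first, so that both are handled by one
    argument. *)
Definition block (H : sgraph) (b : bool) (s : P2 H) : {set H} :=
  [set x | (x \in (val s).1) == b].

Lemma block_connected (H : sgraph) b (s : P2 H) : connected_in (block b s).
Proof.
have := valP s; case/and4P=> _ _ c1 c2.
case: b.
  by rewrite (_ : block _ _ = (val s).1) //; apply/setP => x; rewrite inE eqb_id.
rewrite (_ : block _ _ = (val s).2) //; apply/setP => x.
by rewrite inE P2_compl; case: (_ \in _).
Qed.

Lemma flip_mem (H : sgraph) (x : H) (s : P2 H) : flip x s != s ->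
  forall y, (y \in (val (flip x s)).1) = (y == x) (+) (y \in (val s).1).
Proof.
rewrite /flip /move /insubd; case: insubP => [u _ vu _ y|_]; last by rewrite eqxx.
rewrite /= vu /pair_move; case: (boolP (x \in _)) => /= xA; rewrite !inE;
  by case: eqP => [->|] //=; rewrite ?xA ?(negbTE xA).
Qed.

(** * Partitions of the doubled star graph over a fixed partition of [G] *)

Section Fibre.
Local Open Scope nat_scope.
Variables (G : sgraph) (d : nat) (S : {set G}).
Local Notation H := (dstar d G).
Local Notation E := {s : {set G} | s \in edge_set G}.

Local Notation vtx v := (inl v : svertex H).
Definition copy (e : E) (i : 'I_d) : H := inr (e, i).

Lemma edge_setP (e : E) :
  exists u w, [/\ u != w, sedge u w & val e = [set u; w]].
Proof.
have /imsetP[[u w] /= uw ->] := valP e; exists u, w; split => //.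
by apply: contraTneq uw => ->; rewrite inE /= sedge_irr.
Qed.

Lemma edge_of (u w : G) : sedge u w -> exists e : E, val e = [set u; w].
Proof.
move=> uw; have eP : [set u; w] \in edge_set G.
  by apply/imsetP; exists (u, w).
by exists (Sub [set u; w] eP); rewrite SubK.
Qed.

Lemma edge_set2 (e : E) u w : u \in val e -> w \in val e -> u != w ->
  val e = [set u; w].
Proof.
have [a [b [ab _ ->]]] := edge_setP e.
rewrite !inE => /orP[]/eqP-> /orP[]/eqP->; rewrite ?eqxx // => _.
by rewrite setUC.
Qed.

Lemma vtx_neighbour (C : {set H}) v x : connected_in C -> vtx v \in C ->
  x \in C -> x != vtx v -> exists (e : E) i, v \in val e /\ copy e i \in C.
Proof.
move=> cC vC xC xv; have := connected_in_neighbour cC vC xC.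
rewrite eq_sym => /(_ xv)[[w|[e i]] zC //= vz].
by exists e, i.
Qed.

Lemma copy_neighbour (C : {set H}) (e : E) i x :
  connected_in C -> copy e i \in C ->
  x \in C -> x != copy e i -> exists2 v, v \in val e & vtx v \in C.
Proof.
move=> cC eC xC xe; have := connected_in_neighbour cC eC xC.
rewrite eq_sym => /(_ xe)[[w|[e' i']] zC //= vz].
by exists w.
Qed.

Definition side b := [set v | (v \in S) == b].

(* [compat] characterizes the first blocks of the partitions in [fibre] below. *)
Definition compat (A : {set H}) :=
  [forall v : G, (vtx v \in A) == (v \in S)] &&
  [forall b, forall e : E, forall i,
    (val e \subset side b) ==> ((copy e i \in A) == b)].

Lemma compatP (A : {set H}) : reflect ((forall v, (vtx v \in A) = (v \in S)) /\
  (forall b (e : E) i, val e \subset side b -> (copy e i \in A) = b)) (compat A).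
Proof.
apply: (iffP andP) => -[h1 h2]; split.
- by move=> v; apply/eqP/(forallP h1).
- move=> b e i sb; have /forallP/(_ e)/forallP/(_ i) := forallP h2 b.
  by rewrite sb => /eqP.
- by apply/forallP => v; apply/eqP.
apply/forallP => b; apply/forallP => e; apply/forallP => i; apply/implyP => sb.
by apply/eqP/h2.
Qed.

Definition fibre : {set P2 H} :=
  [set s : P2 H | [forall v : G, (vtx v \in (val s).1) == (v \in S)]].

Lemma fibreP (s : P2 H) : reflect (forall v, (vtx v \in (val s).1) = (v \in S))
  (s \in fibre).
Proof.
rewrite inE; apply: (iffP forallP) => h v; first exact/eqP.
by apply/eqP.
Qed.

Hypotheses (S1 : S != set0) (S0 : ~: S != set0).

Lemma side_inhabited b : exists w, w \in side b.
Proof.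
case: b; [have /set0Pn[w wS] := S1 | have /set0Pn[w wS] := S0]; exists w.
  by rewrite inE wS.
by move: wS; rewrite !inE => /negbTE ->.
Qed.

Lemma fibre_block b s v : s \in fibre -> (vtx v \in block b s) = (v \in side b).
Proof. by move/fibreP => h; rewrite !inE h. Qed.

(** A misplaced copy of an edge inside side [b] would share the other block with some vertex of [G];
    by connectedness one of its endpoints would be in that block, yet both are on side [b]. *)
Lemma fibre_compat (s : P2 H) : s \in fibre -> compat (val s).1.
Proof.
move=> sF; apply/compatP; split; first exact/fibreP.
move=> b e i eb; apply/eqP/negPn/negP => eA.
have eB : copy e i \in block (~~ b) s by rewrite inE; case: b eA {eb} => /=;
  case: (_ \in _).
have [w ws] := side_inhabited (~~ b).
have wB : vtx w \in block (~~ b) s by rewrite fibre_block.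
have [//|v ve] := copy_neighbour (block_connected _ _) eB wB.
rewrite fibre_block //; have := subsetP eb v ve; rewrite !inE => /eqP ->.
by case: b {eb eA eB ws wB}.
Qed.

Hypothesis d0 : 0 < d.

(** A path in [side b] lifts by inserting a copy of each edge, one being available as [0 < d]; every
    copy in [C] hangs on an endpoint in [side b]. *)
Lemma lift_connected b (C : {set H}) : connected_in (side b) ->
  (forall v, (vtx v \in C) = (v \in side b)) ->
  (forall (e : E) i, val e \subset side b -> copy e i \in C) ->
  (forall (e : E) i, copy e i \in C -> exists2 v, v \in val e & v \in side b) ->
  connected_in C.
Proof.
move=> cS vC eC Ce.
pose r := [rel u v | [&& u \in C, v \in C & sedge u v]].
have rs : symmetric r by move=> u v; rewrite /= subdivide_edge_sym andbCA.
have cs : connect_sym r by apply: sym_connect_sym.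
have vv u w : u \in side b -> w \in side b -> connect r (vtx u) (vtx w).
  move=> uS wS; have /forall_inP/(_ _ wS)/connectP[p] := forall_inP cS u uS.
  elim: p u uS => [|z p IHp] u uS /=; first by move=> _ ->.
  case/andP=> /and3P[_ zS uz] pth ew; apply: connect_trans (IHp z zS pth ew).
  have [e ez] := edge_of uz; pose i := Ordinal d0.
  have eiC : copy e i \in C by apply: eC; rewrite ez subUset !sub1set uS.
  apply: (@connect_trans _ _ (copy e i)); apply: connect1.
    by rewrite /= vC uS eiC /= ez set21.
  by rewrite /= vC zS eiC /= ez set22.
have xv x : x \in C -> exists2 v, v \in side b & connect r x (vtx v).
  case: x => [v|[e i]] xC; first by exists v; rewrite -?vC.
  have [v ve vS] := Ce _ _ xC; exists v => //; apply: connect1.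
  by rewrite /= xC vC vS.
apply/forall_inP => x xC; apply/forall_inP => y yC.
have [v vS xv1] := xv x xC; have [w wS yw] := xv y yC.
by apply: connect_trans xv1 (connect_trans (vv v w vS wS) _); rewrite cs.
Qed.

Lemma compat_conn2 (A : {set H}) :
  connected_in (side true) -> connected_in (side false) ->
  compat A -> is_conn2 (A, ~: A).
Proof.
move=> c1 c0 /compatP[vA eA]; rewrite /is_conn2 /=; apply/and4P; split.
- by rewrite disjoints_subset setCK.
- by rewrite setUCr.
- apply: (lift_connected c1) => [v|e i eS|e i eC].
  + by rewrite vA inE eqb_id.
  + by rewrite (eA true).
  case: (boolP (val e \subset side false)) => [/(eA _ _ i)|]; first by rewrite eC.
  case/subsetPn => v ve; rewrite !inE => vS; exists v => //.
  by rewrite inE; case: (_ \in _) vS.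
- apply: (lift_connected c0) => [v|e i eS|e i eC].
  + by rewrite !inE vA; case: (_ \in _).
  + by rewrite inE (eA false).
  case: (boolP (val e \subset side true)) => [/(eA _ _ i)|].
    by move: eC; rewrite inE => /negbTE ->.
  case/subsetPn => v ve; rewrite !inE => vS; exists v => //.
  by rewrite inE; case: (_ \in _) vS.
Qed.

Hypotheses (cS1 : connected_in (side true)) (cS0 : connected_in (side false)).

(** Taking first blocks is a bijection from the fibre to the compatible sets, so counting can ignore
    connectivity. *)
Lemma card_fibre_with (X : pred {set H}) :
  #|[set s : P2 H in fibre | X (val s).1]| = #|[set A | compat A & X A]|.
Proof.
rewrite -(card_imset _ (@first_block_inj H)); apply: eq_card => A; rewrite inE.
apply/imsetP/andP => [[s]|[cA XA]].
  by rewrite inE => /andP[sF Xs] ->; split => //; apply: fibre_compat.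
exists (Sub (A, ~: A) (compat_conn2 cS1 cS0 cA)) => //.
rewrite inE /= XA andbT; apply/fibreP => v /=.
by have /compatP[->] := cA.
Qed.

Definition pattern (e : E) (A : {set H}) : {set 'I_d} :=
  [set i | copy e i \in A].

Definition set_pattern (e : E) (T : {set 'I_d}) (A : {set H}) : {set H} :=
  [set x : H | if x is inr f then if f.1 == e then f.2 \in T else x \in A
               else x \in A].

Definition cut_edge (e : E) := forall b, ~~ (val e \subset side b).

Lemma compat_set_pattern e T A : cut_edge e -> compat A ->
  compat (set_pattern e T A).
Proof.
move=> ce /compatP[vA eA]; apply/compatP; split=> [v|b f i fb].
  by rewrite inE vA.
rewrite inE /=; case: eqP => fe; last exact: eA.
by case/negP: (ce b); rewrite -fe.
Qed.

(** Overwriting the pattern [T] of [e] by [T'] is injective and keeps compatibility. By symmetry all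
    patterns on a cut edge are equally frequent. *)
Lemma card_pattern_le e T T' : cut_edge e ->
  #|[set A | compat A & pattern e A == T]| <=
  #|[set A | compat A & pattern e A == T']|.
Proof.
move=> ce; rewrite -(@card_in_imset _ _ (set_pattern e T')).
  apply: subset_leq_card; apply/subsetP => _ /imsetP[A + ->].
  rewrite !inE => /andP[cA _]; rewrite compat_set_pattern //=.
  by apply/eqP/setP => i; rewrite !inE /= eqxx.
move=> A B; rewrite !inE => /andP[_ /eqP pA] /andP[_ /eqP pB] AB.
apply/setP => -[v|[f i]]; have := congr1 (fun X : {set H} => _ \in X) AB => /=.
  by move/(_ (vtx v)); rewrite !inE.
case: (eqVneq f e) => [->|fe].
  move=> _; have := congr1 (fun X : {set 'I_d} => i \in X) (etrans pA (esym pB)).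
  by rewrite !inE.
by move/(_ (copy f i)); rewrite !inE /= (negbTE fe).
Qed.

Lemma card_patterns e (W : {set {set 'I_d}}) : cut_edge e ->
  #|[set A | compat A & pattern e A \in W]| * 2 ^ d <=
  #|W| * #|[set A | compat A]|.
Proof.
move=> ce; pose N T := #|[set A | compat A & pattern e A == T]|.
have sumN (X : {set {set 'I_d}}) :
    #|[set A | compat A & pattern e A \in X]| = \sum_(T in X) N T.
  rewrite -sum1_card (partition_big (pattern e) (mem X)) /=.
    apply: eq_bigr => T TX; rewrite /N -sum1_card; apply: eq_bigl => A.
    by rewrite !inE; case: eqP => [->|_]; rewrite ?TX ?andbT ?andbF.
  by move=> A; rewrite inE => /andP[].
have -> : #|[set A | compat A]| = \sum_T N T.
  have := sumN setT; rewrite (eq_bigl predT) => [<-|T]; last by rewrite inE.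
  by apply: eq_card => A; rewrite !inE andbT.
rewrite sumN big_distrl /= -sum_nat_const; apply: leq_sum => T _.
have -> : 2 ^ d = #|{set 'I_d}|.
  by rewrite -[RHS]cardsT -powersetT card_powerset cardsT card_ord.
rewrite mulnC -sum_nat_const; apply: leq_sum => T' _.
exact: card_pattern_le.
Qed.

Definition bad (v : G) : {set P2 H} :=
  [set s in fibre | flip (vtx v) s \notin fibre].

(* A connected set missing both endpoints of e can only contain a copy of e as
   an isolated vertex. *)
Lemma copies_le1 (C : {set H}) (e : E) : connected_in C ->
  (forall v, v \in val e -> vtx v \notin C) -> #|pattern e C| <= 1.
Proof.
move=> cC eC; apply/card_le1_eqP => i j; rewrite !inE => iC jC.
apply/eqP/negPn/negP => ij.
have [|v ve vC] := copy_neighbour cC jC iC.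
  by apply: contra ij => /eqP[->].
by case/negP: (eC v ve).
Qed.

(** After the flip, [v] needs a neighbouring copy in the block it joins. That copy was in this block
    before, hence adjacent to an endpoint there, which is on the side opposite to [v]. *)
Lemma bad_cut v s : s \in bad v ->
  exists2 e : E, cut_edge e & v \in val e.
Proof.
rewrite inE => /andP[sF tF].
have ts : flip (vtx v) s != s by apply: contraNneq tF => ->.
pose t := flip (vtx v) s; pose b := v \notin S.
have tm y b' : (y \in block b' t) = ((y == vtx v) (+) (y \in (val s).1) == b').
  by rewrite inE /t flip_mem.
have [w ws] := side_inhabited b.
have wB : vtx w \in block b s by rewrite fibre_block.
have wnv : (vtx w == vtx v) = false.
  apply/eqP => -[wv]; move: ws; rewrite wv inE /b.
  by case: (_ \in _).
have [|||e [i [ve eB]]] := @vtx_neighbour (block b t) v (vtx w) (block_connected _ _).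
- by rewrite tm eqxx (fibreP _ sF) /b addTb eqxx.
- by rewrite tm wnv (fibreP _ sF); move: ws; rewrite inE.
- by rewrite wnv.
exists e => // b'; apply/negP => eb'.
have {}eB : copy e i \in block b s by move: eB; rewrite tm inE /=.
have [//|u ue] := copy_neighbour (block_connected _ _) eB wB.
rewrite fibre_block // => uS.
have := subsetP eb' u ue; have := subsetP eb' v ve; move: uS; rewrite !inE /b.
by case: (v \in S); case: (u \in S); case: b' {eb'}.
Qed.

Lemma card_bad v : #|bad v| * 2 ^ d <= d.+1 * #|fibre|.
Proof.
(* Being a cut edge at [v] depends only on [S], so the edge found from one bad partition serves for
   all of them. *)
case: (set_0Vmem (bad v)) => [->|[s0 /bad_cut[e ce ve]]]; first by rewrite cards0.
(* Patterns with at most one copy in the block that [v] leaves: the empty set and [d] singletons, up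
   to complement. *)
pose W : {set {set 'I_d}} := [set T | #|if v \in S then T else ~: T| <= 1].
have cW : #|W| <= d.+1.
  have -> : #|W| = #|[set T : {set 'I_d} | #|T| <= 1]|.
    rewrite /W; case: (v \in S) => //.
    rewrite -[RHS](card_imset _ (@setC_inj _)); apply: eq_card => T.
    apply/idP/imsetP => [|[T' + ->]]; rewrite !inE ?setCK // => cT.
    by exists (~: T); rewrite ?setCK // inE.
  have -> : [set T : {set 'I_d} | #|T| <= 1] =
     [set T : {set 'I_d} | #|T| == 0] :|: [set T : {set 'I_d} | #|T| == 1].
    by apply/setP => T; rewrite !inE; case: #|T| => [|[]].
  apply: leq_trans (leq_card_setU _ _) _.
  by rewrite !card_draws card_ord bin0 bin1.
have -> : #|fibre| = #|[set A | compat A]|.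
  have := card_fibre_with predT; under eq_finset do rewrite andbT.
  under [in RHS]eq_finset do rewrite andbT.
  by move<-; apply: eq_card => s; rewrite inE.
apply: leq_trans (leq_mul cW (leqnn _)).
apply: leq_trans (card_patterns W ce).
rewrite leq_mul2r -(card_fibre_with (fun A => pattern e A \in W))
  subset_leq_card ?orbT //.
apply/subsetP => s; rewrite [s \in bad v]in_set => /andP[sF tF].
rewrite in_set sF /= in_set.
have ts : flip (vtx v) s != s by apply: contraNneq tF => ->.
have [w we wv] : exists2 w, w \in val e & (w \in S) != (v \in S).
  have /subsetPn[w we] := ce (v \in S).
  by rewrite inE => wS; exists w.
have wnv : w != v by apply: contraNneq wv => ->.
(* The flip moves no copies, so the pattern can be read off after it, when the block contains
   neither endpoint of [e]. *)
have -> : (if v \in S then pattern e (val s).1 else ~: pattern e (val s).1) =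
   pattern e (block (v \in S) (flip (vtx v) s)).
  apply/setP => i; rewrite !inE flip_mem //=.
  by case: (v \in S); rewrite !inE; case: (_ \in _).
apply: copies_le1 (block_connected _ _) _ => u.
rewrite (edge_set2 ve we) 1?eq_sym // !inE flip_mem // => /orP[]/eqP->.
  by rewrite eqxx (fibreP _ sF); case: (v \in S).
rewrite (fibreP _ sF) (_ : (vtx w == vtx v) = false) //.
by apply/eqP => -[/eqP]; rewrite (negbTE wnv).
Qed.

Lemma flip_copy_fibre e i s : s \in fibre -> flip (copy e i) s \in fibre.
Proof.
move=> sF; case: (eqVneq (flip (copy e i) s) s) => [-> //|ne].
by apply/fibreP => v; rewrite flip_mem //= (fibreP _ sF).
Qed.

(** Boundary edges are pairs of a partition in the fibre and a vertex whose flip leaves it. Flips of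
    copies stay inside, so only the [#|G|] vertices of [G] count, each bounded by [card_bad]. *)
Lemma boundary_fibre :
  @edge_boundary (flip_graph H) fibre * 2 ^ d <= #|G| * (d.+1 * #|fibre|).
Proof.
have -> : @edge_boundary (flip_graph H) fibre = \sum_(v : G) #|bad v|.
  transitivity (\sum_(s in fibre) \sum_(x : H) (flip (x : H) s \notin fibre)).
    apply: eq_bigr => s _; rewrite /= /flip_mult.
    under eq_bigr => t _ do rewrite -sum1dep_card big_mkcond /=.
    rewrite exchange_big /=; apply: eq_bigr => x _.
    rewrite -big_mkcondr /= sum1dep_card.
    case: (boolP (flip (x : H) s \in fibre)) => xF /=.
      apply: eq_card0 => t; rewrite inE; apply/negbTE/negP => /andP[].
      by rewrite in_setC => /[swap] /eqP <-; rewrite xF.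
    apply: (@eq_card1 _ (flip (x : H) s)) => t.
    rewrite in_set in_setC [RHS]inE [RHS]eq_sym.
    by case: eqP => [<-|_]; rewrite ?xF ?andbF.
  rewrite exchange_big /= big_sumType /= [X in _ + X]big1 => [|[e i] _].
    rewrite addn0; apply: eq_bigr => v _.
    rewrite -sum1dep_card big_mkcondr; apply: eq_bigr => s _.
    by case: (_ \in _).
  by apply: big1 => s sF; rewrite (flip_copy_fibre e i sF).
rewrite big_distrl /= -sum_nat_const; apply: leq_sum => v _.
exact: card_bad.
Qed.

Lemma fibre_inhabited : fibre != set0.
Proof.
(* All copies of cut edges go to the second block. *)
pose A : {set H} := [set x : H | match x with
  | inl v => v \in S
  | inr f => val f.1 \subset S
  end].
have cA : compat A.
  apply/compatP; split=> [v|b e i eb]; rewrite inE //=.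
  have [u [w [_ _ eE]]] := edge_setP e.
  move: eb; rewrite -[sval e]/(val e) eE !subUset !sub1set !inE.
  by case: (u \in S); case: (w \in S); case: b.
apply/set0Pn; exists (Sub (A, ~: A) (compat_conn2 cS1 cS0 cA)).
by apply/fibreP => v /=; have /compatP[->] := cA.
Qed.

End Fibre.

(** * Size of the graph and of the state space *)

Lemma card_dstar (d : nat) (G : sgraph) :
  #|dstar d G| = (#|G| + #|edge_set G| * d)%N.
Proof. by rewrite card_sum card_prod card_ord card_sig. Qed.

Lemma card_edge_set_le (G : sgraph) : (#|edge_set G| <= #|G| ^ 2)%N.
Proof.
apply: leq_trans (leq_imset_card _ _) _.
by apply: leq_trans (max_card _) _; rewrite card_prod.
Qed.

Lemma card_P2_le (H : sgraph) : (#|P2 H| <= 2 ^ #|H|)%N.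
Proof.
rewrite -(card_imset _ (@first_block_inj H)); apply: leq_trans (max_card _) _.
by rewrite -[leqLHS]cardsT -powersetT card_powerset cardsT.
Qed.

Lemma P2_setC (H : sgraph) (s : P2 H) : ~: (val s).1 = (val s).2.
Proof. by apply/setP => x; rewrite inE P2_compl. Qed.

(** * The smaller of two disjoint fibres as a sparse cut *)

Section SparseCut.
Variables (G : sgraph) (d : nat) (P Q : P2 G).
Hypotheses (d0 : (0 < d)%N) (PQ : P <> Q).
Hypotheses (P1 : (val P).1 <> finset.set0) (P0 : (val P).2 <> finset.set0).
Hypotheses (Q1 : (val Q).1 <> finset.set0) (Q0 : (val Q).2 <> finset.set0).
Local Notation H := (dstar d G).

Lemma fibre_sparse (s : P2 G) : (val s).1 <> finset.set0 ->
  (val s).2 <> finset.set0 ->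
  fibre d (val s).1 != finset.set0 /\
  (@edge_boundary (flip_graph H) (fibre d (val s).1) * 2 ^ d
     <= #|G| * (d.+1 * #|fibre d (val s).1|))%N.
Proof.
move=> /eqP s1; rewrite -P2_setC => /eqP s0.
(* For [S] the first block of [s], the sides of [S] are the blocks of [s], hence connected. *)
split; [apply: fibre_inhabited|apply: boundary_fibre] => //;
  exact: block_connected.
Qed.

Lemma sparse_cut : exists U : {set flip_graph H},
  [/\ U != finset.set0, (#|U| * 2 <= #|flip_graph H|)%N &
    (@edge_boundary (flip_graph H) U * 2 ^ d <= #|G| * (d.+1 * #|U|))%N].
Proof.
pose F (s : P2 G) : {set flip_graph H} := fibre d (val s).1.
have dis : [disjoint F P & F Q].
  rewrite -setI_eq0; apply/eqP/setP => s; rewrite finset.in_setI in_set0.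
  apply/negP => /andP[/fibreP sP /fibreP sQ].
  by case: PQ; apply: P2_eq => v; rewrite -sP sQ.
have cPQ : (#|F P| + #|F Q| <= #|flip_graph H|)%N.
  have := cardsUI (F P) (F Q); move: dis; rewrite -setI_eq0 => /eqP ->.
  by rewrite cards0 addn0 => <-; apply: max_card.
have [FP0 FPb] := fibre_sparse P1 P0.
have [FQ0 FQb] := fibre_sparse Q1 Q0.
case: (leqP #|F P| #|F Q|) => le.
  by exists (F P); split=> //; move: cPQ le; lia.
by exists (F Q); split=> //; move: cPQ le; lia.
Qed.

End SparseCut.

(** * Numerical estimates and conclusion *)

Lemma sqrn_le_exp2 d : (d.+1 ^ 2 <= 4 * 2 ^ d)%N.
Proof.
(* The induction starts at 2, since [(d+2)^2 <= 2 (d+1)^2] fails for d = 0 and d = 1. *)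
case: d => [|[|d]] //; elim: d => // d IHd.
move: IHd; rewrite (expnS 2 d.+2) -!mulnn.
by move: (2 ^ d.+2)%N => m; nia.
Qed.

(** Absorbs the factor [d+1] into half of the exponent: with [h] the square root of 2,
    [d+1 <= 2 h^d] is the root of [sqrn_le_exp2]. *)
Lemma sqrt_exp_bound (R : realType) d : (0 < d)%N ->
  expR (ln 2 / 2 * d%:R) / 4 <= 2 ^+ d.-1 / d.+1%:R :> R.
Proof.
case: d => // d _; rewrite expRM_natr /=; set h : R := expR _.
have h0 : 0 <= h by apply: expR_ge0.
have h2 : h ^+ 2 = 2.
  by rewrite -expRM_natr divfK // lnK // posrE.
have hd : d.+2%:R <= 2 * h ^+ d.+1.
  rewrite -(@ler_pXn2r _ 2) ?nnegrE ?mulr_ge0 ?exprn_ge0 //.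
  rewrite exprMn -exprM mulnC exprM h2.
  rewrite -natrX -[X in _ <= X * _]natrX -natrX -natrM ler_nat.
  exact: sqrn_le_exp2.
rewrite ler_pdivlMr ?ltr0n // mulrAC ler_pdivrMr //.
apply: le_trans (ler_wpM2l (exprn_ge0 d.+1 h0) hd) _.
by rewrite mulrCA -exprMn -expr2 h2 exprS; lra.
Qed.

Theorem mainTheorem13 (R : realType) (G : sgraph) (P Q : P2 G)
    (hG : two_connected G) (hPQ : P <> Q)
    (hP : (val P).1 <> finset.set0 /\ (val P).2 <> finset.set0)
    (hQ : (val Q).1 <> finset.set0 /\ (val Q).2 <> finset.set0) :
  torpidly_mixing [set d : nat | (0 < d)%N]%classic
    (fun d => flip_walk (dstar d G) R) /\
  (forall d : nat, (0 < d)%N ->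
    [/\ (conductance R (flip_graph (dstar d G))
           <= (d.+1%:R / 2 ^+ d.+1)%:E)%E,
        (forall mu : flip_walk (dstar d G) R -> R, stationary mu ->
           ((2 ^+ d.-1 / d.+1%:R)%:E <= tmix mu 4^-1)%E),
        (#|P2 (dstar d G)| <= 2 ^ #|dstar d G|)%N &
        (2 ^ #|dstar d G| <= 2 ^ (#|G| + d * #|G| ^ 2))%N]).
Proof.
have n0 : (0 < #|G|)%N by case: hG => /(leq_trans _) ->.
have bounds d : (0 < d)%N ->
    [/\ (conductance R (flip_graph (dstar d G))
           <= (d.+1%:R / 2 ^+ d.+1)%:E)%E,
        (forall mu : flip_walk (dstar d G) R -> R, stationary mu ->
           ((2 ^+ d.-1 / d.+1%:R)%:E <= tmix mu 4^-1)%E),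
        (#|P2 (dstar d G)| <= 2 ^ #|dstar d G|)%N &
        (2 ^ #|dstar d G| <= 2 ^ (#|G| + d * #|G| ^ 2))%N].
  move=> d0; have [[P1 P0] [Q1 Q0]] := (hP, hQ).
  have [U [U0 halfU bU]] := sparse_cut d0 hPQ P1 P0 Q1 Q0.
  have GH : (#|G| <= #|dstar d G|)%N by rewrite card_dstar leq_addr.
  have H0 : (0 < rdeg (flip_graph (dstar d G)))%N by apply: leq_trans GH.
  (* The factor [#|G|] in the boundary bound is absorbed by the degree [#|dstar d G|]; the extra
     factor 2 comes from laziness. *)
  have ratio : cut_ratio R U <= d.+1%:R / 2 ^+ d.+1.
    rewrite /cut_ratio ler_pdivrMr ?ltr0n ?muln_gt0 ?H0 ?card_gt0 //.
    rewrite mulrAC ler_pdivlMr ?exprn_gt0 // -natrX -!natrM ler_nat /=.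
    rewrite expnS mulnCA -(mulnA 2) [leqRHS]mulnCA leq_pmul2l //.
    by apply: leq_trans bU _; rewrite mulnCA !leq_mul.
  split.
  - by apply: le_trans (conductance_le_cut R U0 halfU) _; rewrite lee_fin.
  - move=> mu smu.
    have -> : 2 ^+ d.-1 / d.+1%:R = (4 * (d.+1%:R / 2 ^+ d.+1))^-1 :> R.
      case: d d0 {U U0 halfU bU GH H0 ratio mu smu} => // d _ /=.
      by rewrite !exprS; field; rewrite expf_neq0 //= -natrD pnatr_eq0.
    by apply: (tmix_ge H0 U0 halfU) => //; rewrite divr_gt0 ?exprn_gt0.
  - exact: card_P2_le.
  - rewrite leq_exp2l // card_dstar leq_add2l mulnC leq_mul2l.
    by rewrite card_edge_set_le orbT.
split=> //.
pose n : R := #|G|%:R; have n_gt0 : 0 < n by rewrite ltr0n.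
pose a : R := expR (2 * n ^+ 2)^-1.
pose C : R := expR (- (ln 2 / 2 / n)) / 4.
(* [a] and [C] are chosen such that C * a ^ ((n + d n^2) ln 2) = 2^(d/2) / 4. *)
exists (fun x => C * a `^ x).
  exists C, a, 0; split => [||//]; first by rewrite divr_gt0 ?expR_gt0.
  by rewrite expR_gt1 invr_gt0 mulr_gt0 ?exprn_gt0.
move=> d d0 mu smu; have [_ /(_ mu smu) le_tmix cP cH] := bounds d d0.
apply: le_trans le_tmix; rewrite lee_fin.
apply: le_trans (sqrt_exp_bound R d0).
(* What remains compares exponents: [ln M / (2 n^2) - ln 2 / (2 n) <= d ln 2 / 2]. *)
rewrite /C /a -expRM mulrAC -expRD ler_pM2r // ler_expR.
set M : R := #|_|%:R.
have M_gt0 : 0 < M.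
  have [U [U0 _ _]] := sparse_cut d0 hPQ hP.1 hP.2 hQ.1 hQ.2.
  by rewrite ltr0n; apply: leq_trans (max_card (mem U)); rewrite card_gt0.
have lnM : ln M <= ln 2 * (n + d%:R * n ^+ 2).
  rewrite /n -natrX -natrM -natrD mulr_natr -lnXn // ler_ln ?posrE ?exprn_gt0 //.
  by rewrite -natrX ler_nat; apply: leq_trans cP cH.
rewrite addrC lerBlDr mulrC ler_pdivrMr ?mulr_gt0 ?exprn_gt0 //.
apply: le_trans lnM _; rewrite le_eqVlt; apply/orP; left; apply/eqP.
by field; rewrite gt_eqF.
Qed.
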